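(* Let $(S,+)$ be a commutative semitopological semigroup, let $\eta$ be an idempotent in $S^*$, and let $A\subseteq S$ be central near $\eta$. Then for each $U\in\eta$ there exist functions $\alpha_U:P_f(\mathcal{T}_\eta)\to S$ and $H_U:P_f(\mathcal{T}_\eta)\to P_f(\mathbb{N})$ such that (1) $\alpha_U(F)\in U$ for each $F\in P_f(\mathcal{T}_\eta)$; (2) if $F,G\in P_f(\mathcal{T}_\eta)$ and $F\subsetneq G$, then $\max H_U(F)<\min H_U(G)$; and (3) whenever $m\in\mathbb{N}$, $X_1,\dots,X_m\in P_f(\mathcal{T}_\eta)$, $X_1\subsetneq X_2\subsetneq\cdots\subsetneq X_m$, and $f_i\in X_i$ for every $i\in\{1,\dots,m\}$, we have \[\sum_{i=1}^m\Big(\alpha_U(X_i)+\sum_{t\in H_U(X_i)}f_i(t)\Big)\in A.\]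
   Context: A semitopological semigroup is a semigroup $(S,+)$ with a (Hausdorff) topology for which all left and right translations are continuous; $S_d$ is $S$ with the discrete topology. A bounded continuous $f:S\to\mathbb{C}$ is weakly almost periodic if $\{R_sf:s\in S\}$, $R_sf(t)=f(t+s)$, is relatively weakly compact in the Banach space $\mathcal{CB}(S)$ of bounded continuous complex functions; $wap(S)$ is the algebra of all such $f$. $S^w$ is the $wap$-compactification of $S$: the spectrum of the $C^*$-algebra $wap(S)$ with evaluation map $\varepsilon:S\to S^w$, made a compact semitopological semigroup by the unique separately continuous operation $+$ for which $\varepsilon$ is a homomorphism (it is the universal semitopological semigroup compactification of $S$). Points of $S^w$ are regarded as families of subsets of $S$ ($e$-ultrafilters). Put $E_\epsilon(f)=\{s\in S:|f(s)|\le\epsilon\}$ and $Z(wap(S))=\{f^{-1}(0):f\in wap(S)\}$. A $z$-filter is a family $\mathcal{A}\subseteq Z(wap(S))$ with $\emptyset\notin\mathcal{A}$, closed under finite intersections and under supersets in $Z(wap(S))$; it is an $e$-filter if $\mathcal{A}=\{E_\epsilon(f):\epsilon>0,\ f\in wap(S),\ E_\delta(f)\in\mathcal{A}\text{ for all }\delta>0\}$; an $e$-ultrafilter is a maximal $e$-filter. The point $\mu$ of the spectrum is identified with the $e$-ultrafilter $\{E_\epsilon(f):f\in wap(S),\ \mu(f)=0,\ \epsilon>0\}$; so ''$U\in\eta$'' makes sense for $\eta\in S^w$, with $U\subseteq S$. For $A\subseteq S$, $cl_{S^w}A$ is the closure of $\varepsilon(A)$ in $S^w$. $S^*=S^w\setminus\varepsilon(S)$.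 $\beta S_d$ is the compact space of ultrafilters on $S$ with operation $A\in p+q\iff\{x\in S:-x+A\in q\}\in p$, where $-x+A=\{y\in S:x+y\in A\}$. For $\eta\in S^w$, $\eta^*=\{u\in\beta S_d:\eta\in\bigcap_{A\in u}cl_{S^w}A\}$. For $\eta$ idempotent, $\eta^*$ is a compact subsemigroup of $\beta S_d$, and $K(\eta^* )$ denotes its smallest two-sided ideal. A set $A\subseteq S$ is central near $\eta$ if there is an idempotent $p\in K(\eta^* )$ with $A\in p$. $\mathbb{N}=\{1,2,\dots\}$; $P_f(X)$ is the set of nonempty finite subsets of $X$. For $B\subseteq\mathbb{N}$, $\overline{d}(B)=\limsup_{n\to\infty}|B\cap\{1,\dots,n\}|/n$. $\mathcal{T}_\eta$ is the set of all $f:\mathbb{N}\to S$ such that $\overline{d}(\{n:f(n)\notin U\})=0$ for every $U\in\eta$. *)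

(* Defs.v *)
From HB Require Import structures.
From mathcomp Require Import all_boot all_order all_algebra.
From mathcomp Require Import finmap complex.
From mathcomp Require Import all_classical all_reals all_analysis.
Import Order.TTheory GRing.Theory Num.Theory.
Import numFieldNormedType.Exports.

Set Implicit Arguments.
Unset Strict Implicit.
Unset Printing Implicit Defensive.

Local Open Scope classical_set_scope.
Local Open Scope ring_scope.
Local Open Scope complex_scope.

(* The algebraic hierarchy of the library does not combine a semigroup without
   neutral element with a topology, hence a dedicated structure. *)
HB.mixin Record isSemitopSemigroup S of Topological S := {
  sadd : S -> S -> S ;
  saddA : associative sadd ;
  semitop_hausdorff : hausdorff_space S ;
  saddl_continuous : forall s : S, continuous (sadd s) ;
  saddr_continuous : forall s : S, continuous (sadd^~ s) }.

#[short(type="semitopSemigroupType")]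
HB.structure Definition SemitopSemigroup :=
  {S of Topological S & isSemitopSemigroup S}.

Notation "x +s y" := (sadd x y) (at level 50, left associativity).

Section WeakTopology.
Variables (K : numFieldType) (V : normedModType K).

Definition topological_dual := {phi : {linear V -> K^o} | continuous phi}.

HB.instance Definition _ := gen_eqMixin topological_dual.
HB.instance Definition _ := gen_choiceMixin topological_dual.

Definition weak_space : Type := V.

HB.instance Definition _ := Topological.copy weak_space
  (initial_topology
     (fun v : V => (fun phi : topological_dual => sval phi v)
        : {ptws topological_dual -> K^o})).

(* [precompact A] is compactness of [closure A] (lemma [precompactE]). *)
Definition relatively_weakly_compact (A : set V) :=
  precompact (A : set weak_space).

End WeakTopology.

Section BoundedContinuous.
Variables (R : realType) (S : topologicalType).
Local Notation C := (R[i]^o).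

Definition bounded_continuous : {pred S -> C} :=
  [pred f : S -> C |
    `[< continuous f /\ exists M : C, forall s, `|f s| <= M >]].

Record CB := MkCB { cb_fun :> S -> C ; _ : cb_fun \in bounded_continuous }.

HB.instance Definition _ := [isSub for cb_fun].
HB.instance Definition _ := [Choice of CB by <:].

Lemma CB_continuous (f : CB) : continuous f.
Proof. by case: f => f /= /asboolP[]. Qed.

Lemma CB_bounded (f : CB) : exists M : C, forall s, `|f s| <= M.
Proof. by case: f => f /= /asboolP[]. Qed.

Lemma bounded_continuous_submod : submod_closed bounded_continuous.
Proof.
split.
  apply/asboolP; split; first by move=> x; exact: cvg_cst.
  by exists 0 => s; rewrite normr0.
move=> a f g /asboolP[fc [M fM]] /asboolP[gc [N gN]]; apply/asboolP; split.
  move=> x; apply: cvgD; last exact: gc.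
  apply: cvgZr; exact: fc.
exists (`|a| * M + N) => s.
apply: le_trans (ler_normD _ _) _; apply: lerD => //.
by rewrite normrM ler_wpM2l.
Qed.

HB.instance Definition _ :=
  GRing.isSubmodClosed.Build _ _ bounded_continuous bounded_continuous_submod.
HB.instance Definition _ := [SubChoice_isSubLmodule of CB by <:].

Definition sup_norm (f : CB) : R := sup [set complex.Re `|f s| | s in [set: S]].

Lemma Re_normE (z : R[i]) : (complex.Re `|z|)%:C = `|z|.
Proof. by rewrite normc_def. Qed.

Lemma sup_normP (f : CB) s : `|f s| <= (sup_norm f)%:C.
Proof.
rewrite -(Re_normE (f s)) lecR; apply: ub_le_sup; last by exists s.
have [M fM] := CB_bounded f; exists (complex.Re M) => _ [t _ <-].
by have := fM t; rewrite lecE => /andP[].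
Qed.

Lemma sup_norm_le (f : CB) (M : R) :
  0 <= M -> (forall s, `|f s| <= M%:C) -> sup_norm f <= M.
Proof.
move=> M0 fM; rewrite /sup_norm.
have [->|/set0P ne] :=
    eqVneq [set complex.Re `|f s| | s in [set: S]] set0; first by rewrite sup0.
by apply: ge_sup => // _ [s _ <-]; rewrite -lecR Re_normE.
Qed.

Lemma sup_norm_ge0 (f : CB) : 0 <= sup_norm f.
Proof.
have [E|/set0P [x [s _ sx]]] :=
    eqVneq [set complex.Re `|f s| | s in [set: S]] set0.
  by rewrite /sup_norm E sup0.
by rewrite -lecR; exact: le_trans (normr_ge0 _) (sup_normP f s).
Qed.

Definition cb_norm (f : CB) : R[i] := (sup_norm f)%:C.

Lemma cb_ler_normD (f g : CB) : cb_norm (f + g) <= cb_norm f + cb_norm g.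
Proof.
rewrite /cb_norm -rmorphD lecR; apply: sup_norm_le => [|s].
  by rewrite addr_ge0 ?sup_norm_ge0.
rewrite rmorphD; apply: le_trans (ler_normD _ _) _.
by apply: lerD; exact: sup_normP.
Qed.

Lemma cb_normrZ_le (a : R[i]) (f : CB) : cb_norm (a *: f) <= `|a| * cb_norm f.
Proof.
rewrite /cb_norm -(Re_normE a) -rmorphM lecR; apply: sup_norm_le => [|s].
  apply: mulr_ge0; last exact: sup_norm_ge0.
  by rewrite -lecR Re_normE; exact: normr_ge0.
rewrite rmorphM /= Re_normE normrM; apply: ler_wpM2l => //.
exact: sup_normP.
Qed.

Lemma cb_normrZ (a : R[i]) (f : CB) : cb_norm (a *: f) = `|a| * cb_norm f.
Proof.
apply/eqP; rewrite eq_le cb_normrZ_le /=.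
have [->|a0] := eqVneq a 0.
  by rewrite normr0 mul0r /cb_norm lecR sup_norm_ge0.
rewrite -ler_pdivlMl ?normr_gt0// -normfV.
by have := cb_normrZ_le a^-1 (a *: f); rewrite scalerA mulVf// scale1r.
Qed.

Lemma cb_normr0_eq0 (f : CB) : cb_norm f = 0 -> f = 0.
Proof.
move=> f0; apply/val_inj/funext => s; apply/eqP.
by rewrite -normr_le0 -f0; exact: sup_normP.
Qed.

HB.instance Definition _ :=
  Lmodule_isNormed.Build R[i] CB cb_ler_normD cb_normrZ cb_normr0_eq0.

End BoundedContinuous.

Section WeaklyAlmostPeriodic.
Variables (R : realType) (S : semitopSemigroupType).
Local Notation C := (R[i]^o).
Local Notation CB := (CB R S).

Lemma right_translate_subproof (s : S) (f : CB) :
  (fun t => f (t +s s)) \in @bounded_continuous R S.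
Proof.
apply/asboolP; split.
  move=> t; apply: (@continuous_comp _ _ _ (fun t : S => t +s s)).
    exact: saddr_continuous.
  exact: CB_continuous.
by have [M fM] := CB_bounded f; exists M.
Qed.

Definition right_translate (s : S) (f : CB) : CB :=
  MkCB (right_translate_subproof s f).

Definition wap (f : CB) : Prop :=
  relatively_weakly_compact [set right_translate s f | s in [set: S]].

Definition wapType := {f : CB | wap f}.

HB.instance Definition _ := gen_eqMixin wapType.
HB.instance Definition _ := gen_choiceMixin wapType.

Definition wap_fun (f : wapType) : S -> C := sval f.
Coercion wap_fun : wapType >-> Funclass.

(* The nonzero multiplicative linear functionals on wap(S).  The operations of
   wap(S) are pointwise; they are referred to through their graphs. *)
Record spectrum := MkSpectrum {
  character :> wapType -> C ;
  character_neq0 : exists f, character f <> 0 ;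
  characterD : forall f g h : wapType,
    (forall s, h s = f s + g s) -> character h = character f + character g ;
  characterZ : forall (a : R[i]) (f h : wapType),
    (forall s, h s = a * f s) -> character h = a * character f ;
  characterM : forall f g h : wapType,
    (forall s, h s = f s * g s) -> character h = character f * character g }.

HB.instance Definition _ := gen_eqMixin spectrum.
HB.instance Definition _ := gen_choiceMixin spectrum.
HB.instance Definition _ := Topological.copy spectrum
  (initial_topology
     (fun mu : spectrum => (mu : wapType -> C) : {ptws wapType -> C})).

Definition point_eval (s : S) (f : CB) : C := f s.

Lemma point_eval_linear s : linear (point_eval s).
Proof. by []. Qed.

HB.instance Definition _ s :=
  GRing.isLinear.Build R[i] CB C _ (point_eval s) (point_eval_linear s).

Lemma point_eval_continuous s : continuous (point_eval s).
Proof.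
apply: bounded_linear_continuous; apply/ex_bound; exists 1.
apply/(@nbhs_norm0P _ CB); exists 1 => //= f /ltW f1.
exact: le_trans (sup_normP f s) f1.
Qed.

Lemma weak_closed1 (f : CB) : closed ([set f] : set (weak_space CB)).
Proof.
pose ev s : topological_dual CB := exist _ (point_eval s : {linear CB -> C})
  (@point_eval_continuous s).
have evc (s : S) : continuous (fun g : weak_space CB => (g : CB) s : C).
  move=> g; apply: (@cvg_comp _ _ _
    (fun g : weak_space CB => (fun phi : topological_dual CB => sval phi g)
       : {ptws topological_dual CB -> C})
    (fun h : {ptws topological_dual CB -> C} => h (ev s))).
    exact: initial_continuous.
  exact: (@proj_continuous _ (fun _ : topological_dual CB => C) (ev s)).
have -> : [set f] = \bigcap_(s : S)
    ((fun g : weak_space CB => (g : CB) s : C) @^-1` [set f s]).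
  apply/seteqP; split=> [g -> s _ //|g fg].
  by apply/val_inj/funext => s; exact: fg.
apply: closed_bigI => s _; apply: preimage_closed.
  by move=> x _; exact: evc.
apply: accessible_closed_set1; apply: hausdorff_accessible.
exact: norm_hausdorff.
Qed.

Definition cst1 (_ : S) : C := 1.

Lemma cst1_subproof : cst1 \in @bounded_continuous R S.
Proof.
apply/asboolP; split; first by move=> x; exact: cvg_cst.
by exists 1 => s; rewrite normr1.
Qed.

Lemma wap_cst1 : wap (MkCB cst1_subproof).
Proof.
exists [set MkCB cst1_subproof].
  by move=> _ [s _ <-]; apply/val_inj.
by split; [exact: compact_set1|exact: weak_closed1].
Qed.

Lemma evaluation_subproof (s : S) :
  exists f : wapType, (fun f : wapType => f s) f <> 0.
Proof. by exists (exist _ _ wap_cst1); apply/eqP/oner_neq0. Qed.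

(* The canonical map S -> S^w. *)
Definition evaluation (s : S) : spectrum :=
  @MkSpectrum (fun f : wapType => f s) (evaluation_subproof s)
    (fun f g h e => e s) (fun a f h e => e s) (fun f g h e => e s).

(* These conditions determine the operation of S^w. *)
Record spectrum_operation (plus : spectrum -> spectrum -> spectrum) : Prop := {
  plusl_continuous : forall mu, continuous (plus mu) ;
  plusr_continuous : forall nu, continuous (plus^~ nu) ;
  plus_evaluation : forall s t,
    plus (evaluation s) (evaluation t) = evaluation (s +s t) }.

Definition spectrum_remainder : set spectrum := ~` range evaluation.

Definition cl_spectrum (A : set S) : set spectrum := closure (evaluation @` A).

(* [0 < e] forces [e : R[i]] to be real. *)
Definition E_set (e : R[i]) (f : S -> C) : set S := [set s | `|f s| <= e].

(* The e-ultrafilter identified with [mu]. *)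
Definition e_ultrafilter (mu : spectrum) : set (set S) :=
  [set U | exists (f : wapType) (e : R[i]),
    [/\ mu f = 0, 0 < e & U = E_set e f]].

End WeaklyAlmostPeriodic.

Section SmallestIdeal.
Variables (X : Type) (op : X -> X -> X).

Definition two_sided_ideal (T I : set X) : Prop :=
  [/\ I !=set0, I `<=` T &
      forall x y, T x -> I y -> I (op x y) /\ I (op y x)].

Definition smallest_ideal (T : set X) : set X :=
  T `&` \bigcap_(I in two_sided_ideal T) I.

End SmallestIdeal.

Section CentralNear.
Variables (R : realType) (S : semitopSemigroupType).

(* Points of beta S_d are the set systems satisfying [UltraFilter]. *)
Definition beta_plus (p q : set_system S) : set_system S :=
  [set A | p [set x | q [set y | A (x +s y)]]].

Definition star_set (eta : spectrum R S) : set (set_system S) :=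
  [set u : set_system S | UltraFilter u /\ forall A, u A -> cl_spectrum A eta].

Definition central_near (eta : spectrum R S) (A : set S) : Prop :=
  exists p : set_system S,
    [/\ smallest_ideal beta_plus (star_set eta) p, beta_plus p p = p & p A].

End CentralNear.

(* The set of nonempty finite subsets of [A]. *)
Definition Pf (X : Type) (A : set X) :=
  {F : set X | [/\ finite_set F, F !=set0 & F `<=` A]}.

Definition Pf_set (X : Type) (A : set X) (F : Pf A) : set X := sval F.
Coercion Pf_set : Pf >-> set.

Definition posnat := {n : nat | (0 < n)%N}.

Definition posnat1 : posnat := exist _ 1%N isT.

(* The elements of a finite set of positive integers, in increasing order. *)
Definition elements (H : Pf [set: posnat]) : seq posnat :=
  sort (fun i j : posnat => (val i <= val j)%N) (fset_set H).

Definition Pf_min (H : Pf [set: posnat]) : nat :=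
  val (head posnat1 (elements H)).
Definition Pf_max (H : Pf [set: posnat]) : nat :=
  val (last posnat1 (elements H)).

Definition upper_density (R : realType) (B : set posnat) : \bar R :=
  limn_esup (fun n : nat =>
    ((\sum_(1 <= k < n.+1) \1_(val @` B) k) / n%:R)%:E).

(* The sum of [b] over a nonempty sequence of indices; without a neutral element
   in [S] the value on the empty sequence is irrelevant. *)
Definition ssum (S : semitopSemigroupType) (I : Type) (i0 : I)
    (r : seq I) (b : I -> S) : S :=
  if r is i :: r' then foldl (fun x j => x +s b j) (b i) r' else b i0.

Definition Tset (R : realType) (S : semitopSemigroupType) (eta : spectrum R S) :
    set (posnat -> S) :=
  [set f | forall U, e_ultrafilter eta U ->
    upper_density R [set n | ~ U (f n)] = 0%E].

(* Main.v *)
Require Import Defs.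
From HB Require Import structures.
From mathcomp Require Import all_boot all_order all_algebra.
From mathcomp Require Import finmap complex zify.
From mathcomp Require Import all_classical all_reals all_analysis.
Import Order.TTheory GRing.Theory Num.Theory.
Import numFieldNormedType.Exports.

Set Implicit Arguments.
Unset Strict Implicit.
Unset Printing Implicit Defensive.

Local Open Scope classical_set_scope.

(** Let [N] be the trace on [S] of the neighbourhood filter of [eta]. Separate
    continuity and [eta + eta = eta] say that [N] is idempotent, i.e. contained
    in [N * N] for the convolution of filters, and [eta^*] is the set of
    ultrafilters containing [N]. Since [N] is generated by the sets of [eta],
    finitely many members of [T_eta] take values in a given set of [N]
    simultaneously at arbitrarily large times. Hence, for finite [F], the
    families [(a + sum_(t in H) f t)_f] with values in [U] for [f] in [F], with
    [a] in [U] and [min H > m], generate a filter whose ultrafilters form an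
    ideal in a closed semigroup containing the diagonal image of [p]. As [p] is
    a minimal idempotent of [eta^*], this gives [a] and [H] with all
    [a + sum_(t in H) f t] in any prescribed set of [p]. The functions [alpha]
    and [H] are then built by recursion on proper inclusion, keeping all sums
    over chains in [{x in A | -x + A in p}]. Closed sets of ultrafilters are
    represented throughout by filters. *)

(** * Convolution of ultrafilters *)

Lemma ultra_setCP (T : Type) (F : set_system T) (A : set T) :
  UltraFilter F -> F (~` A) <-> ~ F A.
Proof.
move=> uF; have pF := @ultra_proper _ _ uF.
split=> [FnA FA|]; last by case: (in_ultra_setVsetC A uF).
by apply: (@filter_not_empty _ F); rewrite -(setICr A); exact: filterI.
Qed.

(** If [A] were missing, the differences of members of [F] with [A] would generate a proper filter,
    and an ultrafilter above it contains the complement of [A]. *)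
Lemma mem_ultra (T : Type) (F : set_system T) (A : set T) :
  ProperFilter F -> (forall u, UltraFilter u -> F `<=` u -> u A) -> F A.
Proof.
move=> pF FA; apply: contrapT => nFA.
have pG : ProperFilter (filter_from F (fun B => B `\` A)).
  apply: filter_from_proper => [|B FB].
    apply: filter_from_filter => [|B C FB FC]; first by exists setT; exact: filterT.
    by exists (B `&` C) => [|x [[? ?] ?]]; [exact: filterI|].
  apply/set0P/eqP => BA; apply: nFA; apply: filterS FB => x Bx.
  by apply: contrapT => nAx; rewrite -[False]/(set0 x) -BA.
have [u [uu Gu]] := ultraFilterLemma pG.
have Fu : F `<=` u by move=> B FB; apply: Gu; exists B => // x [].
have /(ultra_setCP _ uu)[] : u (~` A); last exact: FA.
by apply: Gu; exists setT => [|x []//]; exact: filterT.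
Qed.

(** Larger filters are smaller closed sets of ultrafilters, so this yields minimal closed sets with
    the property [P]. *)
Lemma Zorn_proper_filter (T : Type) (P : set (set_system T)) (F0 : set_system T) :
  ProperFilter F0 -> P F0 ->
  (forall C : set (set_system T), C !=set0 -> total_on C subset ->
     C `<=` P -> P (\bigcup_(F in C) F)) ->
  exists F, [/\ ProperFilter F, F0 `<=` F, P F &
    forall G, ProperFilter G -> F `<=` G -> P G -> G = F].
Proof.
move=> pF0 PF0 Pcup.
pose Q := [set F | F = set0 \/ [/\ ProperFilter F, F0 `<=` F & P F]].
have [|F [QF Fmax]] := @Zorn_bigcup _ Q.
  move=> C CQ Ctot; have [[F [CF F0F]]|C0] :=
    pselect (exists F, C F /\ F !=set0); last first.
    left; apply/seteqP; split=> // A [F CF FA].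
    by case: C0; exists F; split=> //; exists A.
  right; pose C' := C `&` [set F | F !=set0].
  have -> : \bigcup_(F in C) F = \bigcup_(F in C') F.
    apply/seteqP; split=> A [G]; last by move=> [CG _] GA; exists G.
    by move=> CG GA; exists G => //; split=> //; exists A.
  have C'Q G : C' G -> [/\ ProperFilter G, F0 `<=` G & P G].
    by move=> [/CQ[->|//] []].
  have [pF F0F' PF] := C'Q F (conj CF F0F).
  split.
  - apply: Build_ProperFilter.
      by move=> [G /C'Q[pG _ _]]; exact: filter_not_empty.
    split.
    + by exists F => //; exact: filterT.
    + move=> A B [G C'G GA] [H C'H HB].
      have [pG _ _] := C'Q _ C'G; have [pH _ _] := C'Q _ C'H.
      case: (Ctot _ _ C'G.1 C'H.1) => [GH|HG].
        by exists H => //; apply: filterI => //; exact: GH.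
      by exists G => //; apply: filterI => //; exact: HG.
    + move=> A B AB [G C'G GA]; have [pG _ _] := C'Q _ C'G.
      by exists G => //; exact: filterS GA.
  - by move=> A F0A; exists F => //; exact: F0F'.
  - apply: Pcup; first by exists F.
      by move=> G H [CG _] [CH _]; exact: Ctot.
    by move=> G /C'Q[].
have F_max G : ProperFilter G -> F `<=` G -> F0 `<=` G -> P G -> G = F.
  move=> pG FG F0G PG; apply: contrapT => GF; apply: (Fmax G); last by right.
  by split=> // GF'; apply: GF; apply/seteqP.
case: QF => [F0E|[pF F0F PF]]; last first.
  by exists F; split=> // G pG FG; apply: F_max => //; exact: subset_trans F0F FG.
have F00 : F0 = F by apply: F_max => //; rewrite F0E; exact: sub0set.
by exfalso; have : F0 setT by [exact: filterT]; rewrite F00 F0E.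
Qed.

Section Convolution.
Variables (X : Type) (op : X -> X -> X).
Hypothesis opA : associative op.

Definition fconv (p q : set_system X) : set_system X :=
  [set A | p [set x | q [set y | A (op x y)]]].

Lemma fconvA : associative fconv.
Proof.
move=> p q r; apply/funext => A; rewrite /fconv /=; congr p.
apply/funext => x; congr q; apply/funext => y; congr r.
by apply/funext => z; rewrite /= opA.
Qed.

Lemma fconv_sub (p q r : set_system X) : p `<=` q -> fconv p r `<=` fconv q r.
Proof. by move=> pq A; exact: pq. Qed.

Lemma fconv_proper (p q : set_system X) :
  ProperFilter p -> ProperFilter q -> ProperFilter (fconv p q).
Proof.
move=> pp pq; apply: Build_ProperFilter.
  rewrite /fconv /= => /filter_ex[x].
  exact: filter_not_empty.
split.
- apply: (@filterE _ p) => x; exact: filterT.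
- move=> A B pA pB; apply: (@filterS2 _ p) pA pB => x; exact: filterI.
- move=> A B AB; apply: (@filterS _ p) => x; apply: filterS => y; exact: AB.
Qed.

Lemma fconv_ultra (p q : set_system X) :
  UltraFilter p -> UltraFilter q -> UltraFilter (fconv p q).
Proof.
move=> up uq; have pp := @ultra_proper _ _ up; have pq := @ultra_proper _ _ uq.
split=> [|G pG pqG]; first exact: fconv_proper.
apply/seteqP; split=> // A GA; apply: contrapT => nA.
have /pqG GnA : fconv p q (~` A).
  have /(ultra_setCP _ up) : ~ p [set x | q [set y | A (op x y)]] by [].
  by apply: filterS => x /(ultra_setCP _ uq).
by apply: (@filter_not_empty _ G); rewrite -(setICr A); exact: filterI.
Qed.

(* Compactness in terms of filters: the ultrafilters containing [fconv F u]
   are exactly the [fconv v u] with [v] containing [F]. *)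
Lemma fconv_lift (F u w : set_system X) :
  ProperFilter F -> UltraFilter u -> UltraFilter w -> fconv F u `<=` w ->
  exists v, [/\ UltraFilter v, F `<=` v & fconv v u = w].
Proof.
move=> pF uu uw Fuw; have pu := @ultra_proper _ _ uu.
have pw := @ultra_proper _ _ uw.
pose sh A := [set x | u [set y | A (op x y)]].
pose G := filter_from (fun BA : set X * set X => F BA.1 /\ w BA.2)
  (fun BA => BA.1 `&` sh BA.2).
have pG : ProperFilter G.
  apply: filter_from_proper.
    apply: filter_from_filter; first by exists (setT, setT); split; exact: filterT.
    move=> [B A] [B' A'] [/= FB wA] [/= FB' wA'].
    exists (B `&` B', A `&` A') => /=; first by split; exact: filterI.
    move=> x [[Bx B'x] shx]; split; split=> //;
    by apply: filterS shx => y [].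
  move=> [B A] [/= FB wA]; apply/set0P/eqP => BA.
  (* If [B] misses [sh A], then, [u] being an ultrafilter, the complement of [A] lies in
     [fconv F u], hence in [w]. *)
  have /Fuw : fconv F u (~` A).
    apply: filterS FB => x Bx /=; apply/(ultra_setCP _ uu) => shx.
    by rewrite -[False]/(set0 x) -BA.
  by move/(ultra_setCP _ uw).
have [v [uv Gv]] := ultraFilterLemma pG; exists v; split=> //.
  by move=> B FB; apply: Gv; exists (B, setT) => [|x []//]; split=> //; exact: filterT.
symmetry; apply: max_filter => //; first exact: fconv_ultra.
apply: contrapT => vw; apply: vw => A vA; apply: contrapT => /(ultra_setCP _ uw) wnA.
have /(ultra_setCP _ uv)[] : v (~` sh A); last exact: vA.
apply: Gv; exists (setT, ~` A) => [|x [_ /=]]; first by split=> //; exact: filterT.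
by move/(ultra_setCP _ uu).
Qed.

Definition fconv_closed (F : set_system X) :=
  forall u v, UltraFilter u -> UltraFilter v -> F `<=` u -> F `<=` v ->
    F `<=` fconv u v.

(* Ellis' theorem: [fconv_closed F0] says that the ultrafilters containing [F0],
   a closed set, form a semigroup. *)
Lemma fconv_idempotent (F0 : set_system X) :
  ProperFilter F0 -> fconv_closed F0 ->
  exists e, [/\ UltraFilter e, F0 `<=` e & fconv e e = e].
Proof.
move=> pF0 cF0.
(* The ultrafilters above a maximal [F] form a minimal closed semigroup M. *)
have [|F [pF F0F cF Fmax]] := Zorn_proper_filter pF0 cF0.
  move=> C _ _ CP u v uu uv Cu Cv A [F CF FA].
  apply: (CP F CF u v) => // B FB; [apply: Cu|apply: Cv]; by exists F.
have [u [uu Fu]] := ultraFilterLemma pF; have pu := @ultra_proper _ _ uu.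
(* M u is a closed semigroup inside M, so M u = M. *)
have FuE : fconv F u = F.
  have pFu := fconv_proper pF pu; apply: Fmax => //.
    move=> A FA; apply: (@mem_ultra _ F) => v uv Fv.
    exact: (cF v u).
  move=> w1 w2 uw1 uw2 /(fconv_lift pF uu uw1)[v1 [uv1 Fv1 <-]].
  move=> /(fconv_lift pF uu uw2)[v2 [uv2 Fv2 <-]].
  rewrite fconvA; apply: fconv_sub; apply: (cF) => //.
    by apply: fconv_ultra => //; exact: fconv_ultra.
  by apply: (cF).
have [|v [uv Fv vu]] := @fconv_lift F u u pF uu uu; first by rewrite FuE.
(* [G] describes the closed semigroup of all v in M with v u = u. It is nonempty, so it is M and
   contains u. *)
pose G := filter_from (fun BA : set X * set X => F BA.1 /\ u BA.2)
  (fun BA => BA.1 `&` [set x | u [set y | BA.2 (op x y)]]).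
have GP w : UltraFilter w -> G `<=` w <-> F `<=` w /\ fconv w u = u.
  move=> uw; have pw := @ultra_proper _ _ uw; split=> [Gw|[Fw wu] A [[B C] /= [FB uC] BCA]].
    split=> [B FB|].
      by apply: Gw; exists (B, setT) => [|x []//]; split=> //; exact: filterT.
    apply: max_filter => //; first by apply: fconv_proper.
    by move=> A uA; apply: Gw; exists (setT, A) => [|x []//]; split=> //; exact: filterT.
  by apply: filterS BCA _; apply: filterI; [exact: Fw|rewrite -wu in uC].
have pG : ProperFilter G.
  have pv := @ultra_proper _ _ uv.
  apply: Build_ProperFilter.
    have Gv : G `<=` v by apply/(GP _ uv).
    by move/Gv; exact: filter_not_empty.
  apply: filter_from_filter; first by exists (setT, setT); split; exact: filterT.
  move=> [B A] [B' A'] [/= FB wA] [/= FB' wA'].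
  exists (B `&` B', A `&` A') => /=; first by split; exact: filterI.
  move=> x [[Bx B'x] shx]; split; split=> //;
  by apply: filterS shx => y [].
have GE : G = F.
  apply: Fmax => //.
    by move=> B FB; exists (B, setT) => [|x []//]; split=> //; exact: filterT.
  move=> w1 w2 uw1 uw2 /(GP _ uw1)[Fw1 w1u] /(GP _ uw2)[Fw2 w2u].
  apply/GP; first exact: fconv_ultra.
  by split; [apply: (cF)|rewrite -fconvA w2u].
exists u; split=> //; first exact: subset_trans Fu.
by have /(GP _ uu)[] : G `<=` u by rewrite GE.
Qed.

Definition ultra_above (N : set_system X) : set (set_system X) :=
  [set u | UltraFilter u /\ N `<=` u].

(* In other words, the left ideal of [T = ultra_above N] generated by an element
   [p] of [K(T)] is minimal. *)
Lemma smallest_ideal_recurrent (N p x : set_system X) :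
  ProperFilter N -> fconv_closed N ->
  smallest_ideal fconv (ultra_above N) p -> ultra_above N x ->
  exists2 r, ultra_above N r & fconv r (fconv x p) = p.
Proof.
move=> pN cN [_ Kp] [ux Nx].
(* For [F] above [N], [P F] says that the ultrafilters above [F] form a left ideal of T. A maximal
   [F] gives a minimal closed left ideal L, and T m = L for m in L. *)
pose P F := forall u v, UltraFilter u -> UltraFilter v ->
  N `<=` u -> F `<=` v -> F `<=` fconv u v.
have [|F [pF NF PF Fmax]] := @Zorn_proper_filter _ P N pN cN.
  move=> C _ _ CP u v uu uv Nu Cv A [F CF FA].
  by apply: (CP F CF u v) => // B FB; apply: Cv; exists F.
have NmE m : UltraFilter m -> F `<=` m -> fconv N m = F.
  move=> um Fm; have pm := @ultra_proper _ _ um.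
  apply: Fmax; first exact: fconv_proper.
    by move=> A FA; apply: (@mem_ultra _ N) => v uv Nv; exact: (PF v m).
  move=> u v uu uv Nu /(fconv_lift pN um uv)[w [uw Nw <-]].
  by rewrite fconvA; apply: fconv_sub; exact: (cN).
(* L T is a two-sided ideal of T, so p = m t with m in L; if r x m = m, then r x p = p. *)
pose I := [set q | exists m t, [/\ UltraFilter m, F `<=` m, ultra_above N t &
  q = fconv m t]].
have aboveM u v : ultra_above N u -> ultra_above N v -> ultra_above N (fconv u v).
  by move=> [uu Nu] [uv Nv]; split; [exact: fconv_ultra|exact: (cN)].
have [m [t [um Fm Nt pE]]] : I p.
  apply: Kp; split.
  - have [m [um Fm]] := ultraFilterLemma pF.
    exists (fconv m m); exists m, m; split=> //.
    by split=> //; exact: subset_trans Fm.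
  - move=> _ [m [t [um Fm Nt ->]]]; apply: aboveM => //.
    by split=> //; exact: subset_trans Fm.
  - move=> y _ Ny [m [t [um Fm Nt ->]]]; split.
      exists (fconv y m), t; split=> //; last by rewrite fconvA.
        by apply: fconv_ultra => //; case: Ny.
      by case: Ny => uy Ny'; exact: (PF).
    by exists m, (fconv t y); split=> //; [exact: aboveM|rewrite fconvA].
have uxm := fconv_ultra ux um.
have [|r [ur Nr rE]] := fconv_lift (w := m) pN uxm um.
  by rewrite NmE//; exact: (PF).
by exists r => //; rewrite pE [X in fconv r X]fconvA fconvA rE.
Qed.

End Convolution.

(** * Sums with values in a member of a minimal idempotent *)

Lemma fmap_ultra (T T' : Type) (f : T -> T') (u : set_system T) :
  UltraFilter u -> UltraFilter (f @ u).
Proof.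
move=> uu; have pu := @ultra_proper _ _ uu.
split=> [|G pG uG]; first exact: fmap_proper_filter.
apply/seteqP; split=> // A GA; apply: contrapT => nA.
have /uG GnA : (f @ u) (~` A) by apply: (ultra_setCP (f @^-1` A) uu).2.
by apply: (@filter_not_empty _ G); rewrite -(setICr A); exact: filterI.
Qed.

Lemma filter_finite_forall (T : Type) (I : choiceType) (F : set_system T)
    (D : set I) (A : I -> set T) :
  Filter F -> finite_set D -> (forall i, D i -> F (A i)) ->
  F [set x | forall i, D i -> A i x].
Proof.
move=> fF Dfin FA; rewrite -[X in F X]/(\bigcap_(i in D) A i) -(fset_setK Dfin).
by apply: filter_bigI => i; rewrite in_fset_set// inE; exact: FA.
Qed.

Section FiniteSums.
Variable S : semitopSemigroupType.
Hypothesis addC : commutative (@sadd S).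
Implicit Types (a b : S) (s t : seq posnat) (f : posnat -> S).

(** The starting value [a] replaces a neutral element and makes the empty sequence meaningful. *)
Definition sumfrom a s f : S := foldl (fun x i => x +s f i) a s.

Lemma sumfrom_cat a s t f : sumfrom a (s ++ t) f = sumfrom (sumfrom a s f) t f.
Proof. exact: foldl_cat. Qed.

Lemma sumfrom_addl a b s f : sumfrom (a +s b) s f = a +s sumfrom b s f.
Proof.
by elim: s b => //= i s IH b; rewrite /sumfrom /= -saddA; exact: IH.
Qed.

(** Commutativity enters here: it brings [a] and [b] together in front of the two sums. *)
Lemma sumfromD a b s t f :
  sumfrom a s f +s sumfrom b t f = sumfrom (a +s b) (s ++ t) f.
Proof. by rewrite sumfrom_cat -sumfrom_addl [a +s b]addC (sumfrom_addl b a) [b +s _]addC. Qed.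

Lemma sumfrom_ssum a s f : s != [::] ->
  sumfrom a s f = a +s ssum posnat1 s f.
Proof. by case: s => //= i s _; rewrite -sumfrom_addl. Qed.

End FiniteSums.


Section JSet.
Variable S : semitopSemigroupType.
Hypothesis addC : commutative (@sadd S).
Implicit Types (a : S) (b : bool) (s : seq posnat) (U V : set S).
Variables (N : set_system S) (F : set (posnat -> S)).
Hypotheses (pN : ProperFilter N) (N_idem : N `<=` fconv sadd N N).
Hypothesis Ffin : finite_set F.
Hypothesis F_frequent : forall V (m : nat), N V ->
  exists n : posnat, (m < val n)%N /\ forall f, F f -> V (f n).

Definition increasing s := pairwise (fun i j : posnat => (val i < val j)%N) s.

(* With [b = true] the sum over [s] may be empty, which gives the constant
   tuples. *)
Definition tuple_sums (b : bool) (m : nat) U : set ((posnat -> S) -> S) :=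
  [set y | exists a s, [/\ U a, [/\ s = [::] -> b, increasing s &
    all (fun i => m < val i)%N s], y = sumfrom a s & forall f, F f -> U (y f)]].

(** The ultrafilters above [tuple_filter true] form a closed semigroup in which those above
    [tuple_filter false] form an ideal; see [tuple_filter_conv]. *)
Definition tuple_filter (b : bool) : set_system ((posnat -> S) -> S) :=
  filter_from (fun mU : nat * set S => N mU.2) (fun mU => tuple_sums b mU.1 mU.2).

Definition tuple_add (x y : (posnat -> S) -> S) f := x f +s y f.

Lemma tuple_addA : associative tuple_add.
Proof. by move=> x y z; apply/funext => f; rewrite /tuple_add saddA. Qed.

Lemma tuple_sumsS b (m m' : nat) U U' : (m' <= m)%N -> U `<=` U' ->
  tuple_sums b m U `<=` tuple_sums b m' U'.
Proof.
move=> mm' UU' y [a [s [Ua [sb si sm] yE Uy]]]; exists a, s; split; first exact: UU'.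
- by split=> //; apply: sub_all sm => i; exact: leq_ltn_trans.
- by [].
- by move=> f Ff; apply/UU'/Uy.
Qed.

Lemma N_split U : N U -> N [set x | N [set y | U (x +s y)]].
Proof. exact: N_idem. Qed.

(** One index suffices: pick [a] in [U] with [-a + U] in [N], then [n] beyond [m] where all [f] in
    [F] take values in [-a + U]. *)
Lemma tuple_filter_proper b : ProperFilter (tuple_filter b).
Proof.
apply: filter_from_proper.
  apply: filter_from_filter; first by exists (0%N, setT); exact: filterT.
  move=> [m U] [m' U'] /= NU NU'; exists (maxn m m', U `&` U') => /=; first exact: filterI.
  by move=> y Gy; split; apply: tuple_sumsS Gy; rewrite ?leq_maxl ?leq_maxr//; case=> x [].
move=> [m U] /= NU.
have [a [Ua NUa]] := filter_ex (filterI NU (N_split NU)).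
have [n [mn Un]] := F_frequent m NUa.
by exists (sumfrom a [:: n]), a, [:: n]; split=> //; split=> //=; rewrite mn.
Qed.

(** By idempotence of [N], the values of [x] can be taken where the translate of [U] is in [N]; [y]
    then takes its values in finitely many such translates and its indices beyond those of [x]. The
    joined sequence is empty only if both parts are, whence [b1 && b2]. *)
Lemma tuple_filter_conv b1 b2 u v :
  UltraFilter u -> UltraFilter v -> tuple_filter b1 `<=` u -> tuple_filter b2 `<=` v ->
  tuple_filter (b1 && b2) `<=` fconv tuple_add u v.
Proof.
move=> uu uv uG vG B [[m U] /= NU UB].
have pu := @ultra_proper _ _ uu; have pv := @ultra_proper _ _ uv.
pose V := [set x | N [set y | U (x +s y)]].
have NV : N V := N_split NU.
have : u (tuple_sums b1 m V) by apply: uG; exists (m, V).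
apply: (@filterS _ u) => x [a [s [Va [sb si sm] xE Vx]]].
pose W := [set y | U (a +s y)] `&` [set y | forall f, F f -> U (x f +s y)].
have NW : N W.
  apply: filterI => //.
  by apply: (filter_finite_forall (A := fun f => [set y | U (x f +s y)])).
pose m' := maxn m (\max_(i <- s) val i).
have : v (tuple_sums b2 m' W) by apply: vG; exists (m', W).
apply: (@filterS _ v) => y [a' [s' [[Ua' _] [sb' si' sm'] yE Wy]]].
apply: UB; exists (a +s a'), (s ++ s'); split=> //.
- split.
  + by case: s s' {si sm m' NW si' sm' xE yE Vx} sb sb' => // -[]// -> // ->.
  + rewrite /increasing pairwise_cat [pairwise _ s]si [pairwise _ s']si' !andbT.
    apply/allrelP => i j /= si_ sj.
    have /allP/(_ _ sj) := sm'; apply: leq_ltn_trans; rewrite leq_max.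
    apply/orP; right.
    exact: (@leq_bigmax_seq posnat s xpredT (fun i : posnat => val i) i si_ isT).
  + rewrite all_cat sm; apply: sub_all sm' => i; apply: leq_ltn_trans.
    exact: leq_maxl.
- by apply/funext => f; rewrite /tuple_add xE yE (sumfromD addC).
- by move=> f Ff; have [_ /(_ _ Ff)] := Wy f Ff.
Qed.

(* With [d] the diagonal image of [p], an idempotent [e] of the form [fconv x d]
   with [x] above [tuple_filter false] projects in each coordinate of [F] to an
   idempotent of the minimal left ideal of [p]; hence [fconv d e] projects to [p]. *)
Lemma smallest_ideal_J_set p B U (m : nat) :
  smallest_ideal (fconv sadd) (ultra_above N) p -> fconv sadd p p = p -> p B -> N U ->
  exists a s, [/\ U a, s <> [::], increasing s, all (fun i => m < val i)%N s &
    forall f, F f -> B (sumfrom a s f)].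
Proof.
move=> Kp pp pB NU.
have [[up Np] _] := Kp; have prp := @ultra_proper _ _ up.
have sA := @saddA S.
have cN : fconv_closed sadd N.
  move=> u v _ _ Nu Nv A /N_split NA; apply: (Nu).
  by apply: filterS NA => x; exact: Nv.
(* [sumfrom a [::]] is the constant tuple [a], so every projection of [d] is [p]. *)
pose d := (fun a : S => sumfrom a [::]) @ p.
have ud : UltraFilter d by exact: fmap_ultra.
have prd := @ultra_proper _ _ ud.
have dG : tuple_filter true `<=` d.
  move=> A [[k V] /= NV VA]; apply: (@filterS _ p _ _ _ _ (Np _ NV)) => a Va /=.
  by apply: VA; exists a, [::]; split.
have pG := tuple_filter_proper false.
(* The ultrafilters [fconv v d] with [v] above [tuple_filter false] form a closed semigroup, to
   which Ellis' theorem applies. *)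
have [|e [ue Ge ee]] := fconv_idempotent tuple_addA (fconv_proper tuple_add pG prd).
  move=> w1 w2 uw1 uw2 /(fconv_lift pG ud uw1)[v1 [uv1 Gv1 <-]].
  move=> /(fconv_lift pG ud uw2)[v2 [uv2 Gv2 <-]].
  rewrite (fconvA tuple_addA); apply: fconv_sub.
  apply: (@tuple_filter_conv false false) => //.
    by do !apply: fconv_ultra => //.
  exact: (@tuple_filter_conv false true).
have [x [ux Gx xd]] := fconv_lift pG ud ue Ge.
have eG : tuple_filter false `<=` e.
  by rewrite -xd; exact: (@tuple_filter_conv false true).
pose pr f (q : set_system ((posnat -> S) -> S)) := (fun y => y f) @ q.
have prE f : F f -> pr f (fconv tuple_add d e) = p.
  move=> Ff; have prM q r : pr f (fconv tuple_add q r) = fconv sadd (pr f q) (pr f r) by [].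
  have prdE : pr f d = p by [].
  have xN : ultra_above N (pr f x).
    split; first exact: fmap_ultra.
    move=> V NV; apply: Gx; exists (0%N, V) => //= y [a [s [_ _ _ Vy]]].
    exact: Vy.
  (* Write e_f for the projection x_f + p of [e]. From r + e_f = p and idempotence, p + e_f = r +
     e_f + e_f = r + e_f = p. *)
  have [r _ rE] := smallest_ideal_recurrent sA pN cN Kp xN.
  have epr : pr f e = fconv sadd (pr f x) p by rewrite -xd prM prdE.
  have eer : fconv sadd (pr f e) (pr f e) = pr f e by rewrite -prM ee.
  by rewrite prM prdE -{1}rE -epr -(fconvA sA) eer epr rE.
have ude : UltraFilter (fconv tuple_add d e) by exact: fconv_ultra.
have pde := @ultra_proper _ _ ude.
have deB : fconv tuple_add d e [set y | forall f, F f -> B (y f)].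
  apply: (filter_finite_forall (A := fun f => [set y | B (y f)])) => // f Ff.
  by rewrite -[_ [set y | B (y f)]]/(pr f (fconv tuple_add d e) B) prE.
have deG : fconv tuple_add d e (tuple_sums false m U).
  by apply: (@tuple_filter_conv true false) => //; exists (m, U).
have [y [By [a [s [Ua [sb si sm] yE _]]]]] := filter_ex (filterI deB deG).
exists a, s; split=> //; first by move/sb.
by move=> f Ff; rewrite -yE; exact: By.
Qed.

End JSet.

(** * Upper density *)

Section Density.
Variable R : realType.
Local Open Scope ring_scope.
Implicit Types (B : set posnat).

Definition frequency B (n : nat) : R :=
  (\sum_(1 <= k < n.+1) \1_(val @` B) k) / n%:R.

Lemma frequency_ge0 B n : 0 <= frequency B n.
Proof. by apply: divr_ge0 => //; apply: sumr_ge0 => k _; rewrite indicE. Qed.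

Lemma le_frequency B B' n : B `<=` B' -> frequency B n <= frequency B' n.
Proof.
move=> BB'; rewrite ler_wpM2r ?invr_ge0//; apply: ler_sum => k _.
rewrite !indicE; case: (boolP (k \in _)) => //; rewrite inE => -[i Bi <-].
by rewrite mem_set//; exists i => //; exact: BB'.
Qed.

Lemma frequencyU B B' n :
  frequency (B `|` B') n <= frequency B n + frequency B' n.
Proof.
rewrite -mulrDl ler_wpM2r ?invr_ge0// -big_split; apply: ler_sum => k _ /=.
rewrite !indicE image_setU in_setU.
by do 2 case: (k \in _) => /=; rewrite ?addr0 ?add0r ?lerDl.
Qed.

Lemma frequencyT n : (0 < n)%N -> frequency setT n = 1.
Proof.
move=> n0; rewrite /frequency (eq_big_nat _ _ (F2 := fun=> 1)) => [|k /andP[k0 _]].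
  by rewrite sumr_const_nat subn1 /= divff// pnatr_eq0 -lt0n.
by rewrite indicE mem_set//; exists (exist _ k k0).
Qed.

Lemma frequency_initial m n :
  frequency [set i : posnat | (val i <= m)%N] n <= m%:R / n%:R.
Proof.
rewrite ler_wpM2r ?invr_ge0//.
have H j : (\sum_(1 <= k < j.+1) (k <= m) = minn j m)%N.
  elim: j => [|j IH].
    by rewrite min0n big_geq.
  by rewrite big_nat_recr//= IH; lia.
apply: (@le_trans _ _ (\sum_(1 <= k < n.+1) (k <= m)%N%:R)).
  apply: ler_sum => k _; rewrite indicE ler_nat.
  by case: (boolP (k \in _)) => //; rewrite inE => -[i /= im <-]; rewrite im.
by rewrite -natr_sum H ler_nat geq_minr.
Qed.

Lemma upper_density_eq0 B :
  upper_density R B = 0%E -> frequency B @ \oo --> (0 : R).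
Proof.
move=> B0; have : (fun n => (frequency B n)%:E) @ \oo --> (0 : R)%:E.
  apply: limn_esup_le_cvg => [|n]; last by rewrite lee_fin frequency_ge0.
  by rewrite -[leLHS]/(upper_density R B) B0.
by move/fine_cvgP => [].
Qed.

Lemma frequency_cvg0_le B (u : nat -> R) :
  (forall n, frequency B n <= u n) -> u @ \oo --> (0 : R) ->
  frequency B @ \oo --> (0 : R).
Proof.
move=> Bu u0; apply: (squeeze_cvgr (f := fun=> 0) (h := u)) => //; last exact: cvg_cst.
by apply: nearW => n; rewrite frequency_ge0 Bu.
Qed.

(** Convergence to 0 makes finite intersections a matter of adding limits. A sequence in [Tset eta]
    maps this filter to one containing the e-ultrafilter of [eta]. *)
Definition full_density : set_system posnat :=
  [set B | frequency (~` B) @ \oo --> (0 : R)].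

Lemma full_density_proper : ProperFilter full_density.
Proof.
apply: Build_ProperFilter.
  rewrite /full_density /= setC0 => f0.
  have f1 : frequency setT @ \oo --> (1 : R).
    apply: cvg_near_cst; near=> n; rewrite frequencyT//.
    by near: n; exact: nbhs_infty_gt.
  suff f01 : (0 : R) = 1 by move/eqP: f01; rewrite eq_sym oner_eq0.
  exact: (cvg_unique _ f0 f1).
split.
- rewrite /full_density /= setCT; apply: (frequency_cvg0_le (u := fun=> 0)); last exact: cvg_cst.
  by move=> n; apply: (le_trans (@le_frequency _ [set i : posnat | (val i <= 0)%N] n _)) => //;
    apply: (le_trans (frequency_initial 0 n)); rewrite mul0r.
- move=> A B A0 B0.
  apply: (frequency_cvg0_le (u := fun n => frequency (~` A) n + frequency (~` B) n)).
    by move=> n; rewrite setCI frequencyU.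
  by rewrite -[X in _ --> X]addr0; exact: cvgD.
- move=> A B AB A0; apply: frequency_cvg0_le A0 => n.
  by apply: le_frequency; exact: subsetC.
Unshelve. all: by end_near. Qed.

Lemma full_density_tail m : full_density [set i : posnat | (m < val i)%N].
Proof.
apply: (frequency_cvg0_le (u := fun n => m%:R / n%:R)) => [n|].
  apply: le_trans (frequency_initial m n); apply: le_frequency => i /=.
  by move/negP; rewrite -leqNgt.
rewrite -(mulr0 (m%:R : R)); apply: cvgMr.
rewrite -cvg_shiftS; exact: cvg_harmonic.
Qed.

(** The image of [full_density] under each [f] contains [N] by the minimality assumption; finite
    intersections with a tail stay nonempty. *)
Lemma full_density_frequent (S : semitopSemigroupType) (eta : spectrum R S)
    (N : set_system S) (F : set (posnat -> S)) V (m : nat) :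
  (forall G : set_system S, Filter G -> e_ultrafilter eta `<=` G -> N `<=` G) ->
  finite_set F -> F `<=` Tset eta -> N V ->
  exists n : posnat, (m < val n)%N /\ forall f, F f -> V (f n).
Proof.
move=> Nmin Ffin FT NV; have pd := full_density_proper.
have FV f : F f -> full_density [set n | V (f n)].
  move=> Ff; apply: (Nmin (f @ full_density)) => // U eU.
  exact: upper_density_eq0 (FT _ Ff U eU).
have dV := filter_finite_forall (A := fun f => [set n | V (f n)]) _ Ffin FV.
exact: filter_ex (filterI (full_density_tail m) (dV _)).
Qed.

End Density.

(** * The neighbourhood filter of a point of the spectrum *)

Lemma cvg_initial (X : choiceType) (Y : topologicalType) (f : X -> Y)
    (F : set_system X) (x : initial_topology f) :
  Filter F -> f @ F --> f x -> F --> x.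
Proof.
move=> FF fFx A [_ [[B Bop <-] Bfx BA]].
by apply: filterS BA _; apply: fFx; apply: open_nbhs_nbhs.
Qed.

(** The weak topology and the topology of the spectrum are both of this form. *)
Lemma cvg_initial_ptws (X : choiceType) (I : Type) (Y : topologicalType)
    (f : X -> {ptws I -> Y}) (F : set_system X) (x : initial_topology f) :
  Filter F -> (forall i, f z i @[z --> F] --> f x i) -> F --> x.
Proof.
move=> FF Fx; apply: cvg_initial; apply/cvg_sup => i.
by apply: cvg_initial; exact: Fx.
Qed.

Lemma initial_ptws_continuous (X : choiceType) (I : eqType) (Y : topologicalType)
    (f : X -> {ptws I -> Y}) (i : I) :
  continuous (fun x : initial_topology f => f x i).
Proof.
move=> x; apply: (@cvg_comp _ _ _ f (fun h : {ptws I -> Y} => h i)).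
  exact: initial_continuous.
exact: (@proj_continuous _ (fun _ : I => Y) i).
Qed.

Section WeakTranslation.
Variables (K : numFieldType) (V : normedModType K).
Local Open Scope ring_scope.

Lemma weak_translation_continuous (c : V) :
  continuous (fun v : weak_space V => (v : V) + c : weak_space V).
Proof.
move=> v; apply: cvg_initial_ptws => [|phi].
  exact: fmap_filter (nbhs_filter v).
have FF : Filter (nbhs (v : weak_space V)) := nbhs_filter v.
have phiD w : sval phi (w + c) = sval phi w + sval phi c := linearD _ _ _.
suff : sval phi w + sval phi c @[w --> (v : weak_space V)] --> sval phi (v : V) + sval phi c.
  move=> phi_cvg A /=; rewrite phiD => /phi_cvg.
  apply: (@filterS _ _ (nbhs_filter v)) => w.
  by move=> Aw; change (A (sval phi (w + c))); rewrite phiD; exact: Aw.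
apply: (cvgD _ (@cvg_cst _ _ _ _ FF)).
exact: (@initial_ptws_continuous V _ _
  (fun w => (fun phi : topological_dual V => sval phi w)
     : {ptws topological_dual V -> K^o}) phi v).
Qed.

End WeakTranslation.

Section WapTranslate.
Variables (R : realType) (S : semitopSemigroupType).
Local Open Scope ring_scope.
Local Notation C := (R[i]^o).
Local Notation CB := (CB R S).

(** Constants are invariant under translation, so adding one shifts the orbit of [g] by [c], and
    shifts are weak homeomorphisms. *)
Lemma wap_addcst (g : CB) (a : C) : wap g -> wap (g + a *: MkCB (@cst1_subproof R S)).
Proof.
set c := a *: _; move=> [K gK [Kc Kcl]].
exists ((fun v : weak_space CB => (v : CB) + c : weak_space CB) @` K).
  move=> _ [s _ <-] /=; exists (right_translate s g); first by apply: gK; exists s.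
  by apply/val_inj/funext.
split.
  apply: continuous_compact => //; apply: continuous_subspaceT.
  exact: weak_translation_continuous.
have -> : (fun v : weak_space CB => (v : CB) + c : weak_space CB) @` K =
  (fun v : weak_space CB => (v : CB) - c : weak_space CB) @^-1` K.
  apply/seteqP; split=> [_ [v Kv <-]|v Kv] /=; first by rewrite addrK.
  by exists ((v : CB) - c) => //; rewrite subrK.
by apply: closed_comp => // v _; exact: weak_translation_continuous.
Qed.

End WapTranslate.

Section PointFilter.
Variables (R : realType) (S : semitopSemigroupType) (eta : spectrum R S).
Local Open Scope ring_scope.
Local Notation C := (R[i]^o).

Definition trace_nbhs : set_system S :=
  filter_from (nbhs eta) (fun W => @evaluation R S @^-1` W).

Lemma trace_nbhs_filter : Filter trace_nbhs.
Proof.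
apply: filter_from_filter; first by exists setT; exact: filterT.
by move=> A B eA eB; exists (A `&` B) => //; exact: filterI.
Qed.

Lemma character_continuous (g : wapType R S) :
  continuous (fun mu : spectrum R S => mu g : C).
Proof.
exact: (@initial_ptws_continuous _ _ _
  (fun mu : spectrum R S => (mu : wapType R S -> C) : {ptws wapType R S -> C}) g).
Qed.

Lemma e_ultrafilter_trace : e_ultrafilter eta `<=` trace_nbhs.
Proof.
move=> _ [g [e [g0 e0 ->]]].
exists [set mu : spectrum R S | `|mu g| < e]; last by move=> s /ltW.
have := @character_continuous g eta; rewrite /continuous_at /= g0 => /cvgr0_norm_lt.
exact.
Qed.

Lemma character_cst1 : eta (exist _ _ (@wap_cst1 R S)) = 1.
Proof.
have [f f0] := character_neq0 eta.
have := @characterM _ _ eta f (exist _ _ (@wap_cst1 R S)) f (fun s => esym (mulr1 _)).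
by move/eqP; rewrite -[X in X == _]mulr1 => /eqP/mulfI ->//; apply/eqP.
Qed.

(** Convergence to [eta] is tested on each [g]: the function [h = g - eta g] vanishes at [eta], and
    on [E_set e h] the values of [g] are within [e] of [eta g]. *)
Lemma trace_nbhs_min (G : set_system S) :
  Filter G -> e_ultrafilter eta `<=` G -> trace_nbhs `<=` G.
Proof.
move=> FG eG V [W etaW WV]; apply: filterS WV _.
suff : @evaluation R S @ G --> eta by exact.
apply: cvg_initial_ptws => g.
rewrite -[X in X --> _]/((fun s => g s : C) @ G).
apply/cvgrPdist_le => e e0.
pose one : wapType R S := exist _ _ (@wap_cst1 R S).
pose h : wapType R S := exist _ _ (wap_addcst (- eta g) (svalP g)).
have hE s : h s = g s + (- eta g) * 1 by [].
(* The constant function [- eta g], as a translate of the function 1. *)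
pose k : wapType R S := exist _ _ (wap_addcst (- eta g - 1) (@wap_cst1 R S)).
have kE s : k s = (- eta g) * one s
  by rewrite -[LHS]/(1 + (- eta g - 1) * 1) !mulr1 addrC subrK.
have h0 : eta h = 0.
  rewrite (@characterD _ _ eta g k h) => [|s]; last by rewrite hE kE.
  by rewrite (@characterZ _ _ eta (- eta g) one k)// character_cst1 mulr1 subrr.
have : G (E_set e h) by apply: eG; exists h, e.
by apply: filterS => s; rewrite /E_set /= hE mulr1 distrC.
Qed.

(** [eta] is in the closure of every member of [u] iff no complement of a trace of a neighbourhood
    belongs to [u]. *)
Lemma star_setE : star_set eta = ultra_above trace_nbhs.
Proof.
apply/seteqP; split=> u [uu H]; split=> //; have pu := @ultra_proper _ _ uu.
  move=> V [W etaW WV]; apply: contrapT => /(ultra_setCP _ uu)/H/(_ _ etaW).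
  by move=> [_ [[s nVs <-] Ws]]; apply: nVs; exact: WV.
move=> A uA W etaW.
have uW : u (@evaluation R S @^-1` W) by apply: H; exists W.
have [s [As Ws]] := filter_ex (filterI uA uW).
by exists (evaluation R s); split=> //; exists s.
Qed.

Lemma trace_nbhs_proper : star_set eta !=set0 -> ProperFilter trace_nbhs.
Proof.
rewrite star_setE => -[u [uu Nu]]; have pu := @ultra_proper _ _ uu.
apply: Build_ProperFilter; last exact: trace_nbhs_filter.
by move/Nu; exact: filter_not_empty.
Qed.

Lemma trace_nbhs_idempotent plus : spectrum_operation plus -> plus eta eta = eta ->
  trace_nbhs `<=` fconv sadd trace_nbhs trace_nbhs.
Proof.
move=> [pl pr pe] ee V [W etaW WV].
(* Where [plus (evaluation s) eta] falls in the interior, [W] is a neighbourhood of it, so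
   continuity in the second argument applies next. *)
pose W' := W^°.
have W'eta : nbhs (plus eta eta) W' by rewrite ee; exact: nbhs_interior.
exists [set mu | W' (plus mu eta)]; first exact: pr W'eta.
move=> s Ws; exists [set nu | W (plus (evaluation R s) nu)]; first exact: pl Ws.
by move=> t Wst; apply: WV; rewrite /= -pe.
Qed.

End PointFilter.

(** * Recursion over finite sets of sequences *)

(** The value at [i] is picked by choice from a specification that, by locality, sees only values
    below [i]; elsewhere [ext] fills in the default [v0]. *)
Lemma well_founded_choice (I V : Type) (lt : I -> I -> Prop)
    (spec : I -> (I -> V) -> V -> Prop) :
  inhabited V -> well_founded lt ->
  (forall i g g' v, (forall j, lt j i -> g j = g' j) -> spec i g v -> spec i g' v) ->
  (forall i g, (forall j, lt j i -> spec j g (g j)) -> exists v, spec i g v) ->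
  exists g, forall i, spec i g (g i).
Proof.
move=> [v0] wf local step.
pose ext i (r : forall j, lt j i -> V) j :=
  if pselect (lt j i) is left ltji then r j ltji else v0.
pose pick (P : V -> Prop) :=
  if pselect (exists v, P v) is left e then projT1 (cid e) else v0.
have pickP P v : P v -> P (pick P).
  move=> Pv; rewrite /pick; case: pselect => [e|[]]; last by exists v.
  exact: projT2 (cid e).
pose body i r := pick (spec i (ext i r)).
have bodyE i r r' : (forall j ltji, r j ltji = r' j ltji) -> body i r = body i r'.
  move=> rr'; suff -> : r = r' by [].
  by apply/functional_extensionality_dep => j; apply/functional_extensionality_dep.
have gE := Fix_eq wf (fun=> V) body bodyE.
set g := Fix wf (fun=> V) body in gE.
have extE i j : lt j i -> ext i (fun j _ => g j) j = g j.
  by rewrite /ext; case: pselect.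
exists g; elim/(well_founded_ind wf) => i IH.
have [v iv] := step i g IH.
apply: (local _ (ext i (fun j _ => g j))) => [j /extE//|].
by rewrite gE; apply: (pickP _ v); apply: local iv => j /extE.
Qed.

Lemma finite_bounded (I : Type) (D : set I) (h : I -> nat) :
  finite_set D -> exists m, forall i, D i -> (h i <= m)%N.
Proof.
move=> /(finite_image h) hD; exists (\max_(k <- fset_set (h @` D)) k) => i Di.
apply: (@leq_bigmax_seq _ _ xpredT id) => //.
by rewrite in_fset_set// inE; exists i.
Qed.

Section FiniteSubsets.
Variables (X : choiceType) (A : set X).

Lemma Pf_set_inj : injective (@Pf_set X A).
Proof.
by move=> [F PF] [G PG]; rewrite /Pf_set /= => FG; subst G; congr exist; exact: Prop_irrelevance.
Qed.

Lemma finite_powerset (F : set X) : finite_set F -> finite_set [set G | G `<=` F].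
Proof.
move=> Ffin; apply: (@sub_finite_set _ _
  ((fun B : {fset X} => [set` B]) @` [set` fpowerset (fset_set F)])); last first.
  by apply: finite_image; exact: finite_fset.
move=> G /= GF; have Gfin := sub_finite_set GF Ffin.
exists (fset_set G); last exact: fset_setK.
by rewrite /= fpowersetE -fset_set_sub.
Qed.

Lemma finite_proper_subsets (F : Pf A) : finite_set [set G : Pf A | G `<` F].
Proof.
have [Ffin _ _] := svalP F.
apply: (@sub_finite_set _ _ (@Pf_set X A @^-1` [set G | G `<=` Pf_set F])).
  by move=> G [].
by apply: finite_preimage; [move=> G H _ _; exact: Pf_set_inj|exact: finite_powerset].
Qed.

Lemma Pf_well_founded : well_founded (fun G F : Pf A => G `<` F).
Proof.
suff acc n (F : Pf A) : (#|` fset_set F| < n)%N -> Acc (fun G F : Pf A => G `<` F) F.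
  by move=> F; exact: (acc (#|` fset_set F|.+1)).
elim: n F => [F|n IH F Fn]; first by rewrite ltn0.
constructor => G GF; apply: IH.
have [Ffin _ _] := svalP F; have [Gfin _ _] := svalP G.
apply: leq_trans (_ : (#|` fset_set F| <= n)%N) => //.
apply: fproper_ltn_card; case: GF => GF FG; rewrite fproperE; apply/andP; split.
  by rewrite -fset_set_sub.
by apply/negP; rewrite -fset_set_sub.
Qed.

End FiniteSubsets.

Lemma increasing_elements s : s <> [::] -> increasing s ->
  exists H : Pf [set: posnat], elements H = s.
Proof.
move=> s0 si.
have PH : [/\ finite_set [set` s], [set` s] !=set0 & [set` s] `<=` [set: posnat]].
  split=> //.
  by case: s s0 {si} => // i s _; exists i; rewrite /= mem_head.
exists (exist (fun F : set posnat => [/\ finite_set F, F !=set0 & F `<=` _]) _ PH).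
rewrite /elements /Pf_set /=.
have ltT : transitive (fun i j : posnat => (val i < val j)%N) by move=> ? ? ?; exact: ltn_trans.
have ssort : sorted (fun i j : posnat => (val i < val j)%N) s by rewrite sorted_pairwise.
apply: (@sorted_eq _ (fun i j : posnat => (val i <= val j)%N)).
- by move=> ? ? ?; exact: leq_trans.
- by move=> i j /anti_leq/val_inj.
- by apply: sort_sorted => i j; exact: leq_total.
- by apply: sub_sorted ssort => i j; exact: ltnW.
rewrite perm_sort; apply: uniq_perm; first exact: fset_uniq.
  by apply: (sorted_uniq ltT) => // i; rewrite ltnn.
move=> i; have [fs _ _] := PH; rewrite in_fset_set; last exact: fs.
by apply/idP/idP => [/set_mem|is_]; last exact: mem_set.
Qed.

Lemma ssum_rcons (S : semitopSemigroupType) (I : Type) (i0 j : I) (s : seq I)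
    (b : I -> S) : (0 < size s)%N ->
  ssum i0 (s ++ [:: j]) b = ssum i0 s b +s b j.
Proof. by case: s => //= i s _; rewrite foldl_cat. Qed.


(** * Construction of [alpha] and [H] along proper inclusion *)

Section CentralSets.
Variables (S : semitopSemigroupType) (N p : set_system S) (T : set (posnat -> S)).
Variables (A U : set S).
Hypothesis addC : commutative (@sadd S).
Hypotheses (pN : ProperFilter N) (N_idem : N `<=` fconv sadd N N).
Hypothesis T_frequent : forall (F : set (posnat -> S)) V (m : nat),
  finite_set F -> F `<=` T -> N V ->
  exists n : posnat, (m < val n)%N /\ forall f, F f -> V (f n).
Hypotheses (Kp : smallest_ideal (fconv sadd) (ultra_above N) p)
  (pp : fconv sadd p p = p) (pA : p A) (NU : N U).

Let up : UltraFilter p. Proof. by case: Kp => -[]. Qed.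
Let prp : ProperFilter p := @ultra_proper _ _ up.
#[local] Existing Instance prp.

Definition star_part : set S := A `&` [set x | p [set y | A (x +s y)]].

Lemma star_part_mem : p star_part.
Proof.
have ppA : fconv sadd p p A by rewrite pp.
exact: filterI pA ppA.
Qed.

(** As [-x + A] is in [p] and [p] is idempotent, the [y] with [-(x + y) + A] in [p] form a set in
    [p]. *)
Lemma star_part_translate x : star_part x -> p [set y | star_part (x +s y)].
Proof.
move=> [_ pxA]; apply: filterI => //.
have : fconv sadd p p [set y | A (x +s y)] by rewrite pp.
apply: (@filterS _ p) => y; apply: (@filterS _ p) => z /=.
by rewrite saddA.
Qed.

Definition block (a : S) (H : Pf [set: posnat]) (f : posnat -> S) : S :=
  a +s ssum posnat1 (elements H) f.

(* A value consists of [alpha F], [H F] and a finite set containing all sums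
   over chains that end in [F]. *)
Definition chain_spec (F : Pf T) (g : Pf T -> S * Pf [set: posnat] * set S)
    (v : S * Pf [set: posnat] * set S) : Prop :=
  [/\ U v.1.1,
      forall G : Pf T, G `<` F -> (Pf_max (g G).1.2 < Pf_min v.1.2)%N,
      finite_set v.2 /\ v.2 `<=` star_part,
      forall f, Pf_set F f -> v.2 (block v.1.1 v.1.2 f) &
      forall (G : Pf T) r f, G `<` F -> (g G).2 r -> Pf_set F f ->
        v.2 (r +s block v.1.1 v.1.2 f)].

Lemma chain_spec_local (F : Pf T) g g' v : (forall G : Pf T, G `<` F -> g G = g' G) ->
  chain_spec F g v -> chain_spec F g' v.
Proof.
move=> gg' [Uv Hv fv cv cv2]; split=> // [G GF|G r f GF]; first by rewrite -gg'//; exact: Hv.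
by rewrite -gg'//; exact: cv2 GF.
Qed.

Lemma chain_spec_step (F : Pf T) g : (forall G : Pf T, G `<` F -> chain_spec G g (g G)) ->
  exists v, chain_spec F g v.
Proof.
move=> IH; have [Ffin _ FT] := svalP F.
have Dfin := finite_proper_subsets F.
have [m mP] := finite_bounded (fun G => Pf_max (g G).1.2) Dfin.
(* [Q] collects the sums recorded strictly below [F]. It is finite, so a single set in [p] is
   carried into [star_part] by all translations by members of [Q]. *)
pose Q := \bigcup_(G in [set G : Pf T | G `<` F]) (g G).2.
have Qfin : finite_set Q by apply: bigcup_finite => // G /IH[_ _ []].
have Qstar : Q `<=` star_part by move=> r [G /IH[_ _ [_ +] _ _]]; apply.
have pB : p (star_part `&` [set y | forall r, Q r -> star_part (r +s y)]).
  apply: filterI; first exact: star_part_mem.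
  apply: (filter_finite_forall (A := fun r => [set y | star_part (r +s y)])) => //.
  by move=> r /Qstar; exact: star_part_translate.
have [a [s [Ua s0 si sm sB]]] := smallest_ideal_J_set addC pN N_idem Ffin
  (fun V k => T_frequent k Ffin FT) m Kp pp pB NU.
have [H Hs] := increasing_elements s0 si.
have sumE f : sumfrom a s f = block a H f.
  by rewrite /block Hs sumfrom_ssum//; apply/eqP.
(* Chains ending in [F]: [F] alone, or a chain ending strictly below [F] followed by [F]. *)
pose Rs := block a H @` F `|` (fun rf => rf.1 +s block a H rf.2) @` (Q `*` F).
exists (a, H, Rs); split=> //=.
- move=> G GF; apply: leq_ltn_trans (mP _ GF) _.
  by rewrite /Pf_min Hs; case: (s) s0 sm => //= i s' _ /andP[].
- split.
    by rewrite finite_setU; split; apply: finite_image => //; exact: finite_setX.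
  move=> _ [[f Ff <-]|[[r f] [/= Qr Ff] <-]]; rewrite -sumE.
    by have [] := sB f Ff.
  by have [_ /(_ r Qr)] := sB f Ff.
- by move=> f Ff; left; exists f.
- by move=> G r f GF gr Ff; right; exists (r, f) => //; split=> //; exists G.
Qed.

Lemma central_sets_chain :
  exists (alpha : Pf T -> S) (H : Pf T -> Pf [set: posnat]),
    [/\ (forall F : Pf T, U (alpha F)),
        (forall F G : Pf T, F `<` G -> (Pf_max (H F) < Pf_min (H G))%N) &
        (forall (m : nat) (X : nat -> Pf T) (f : nat -> posnat -> S),
          (0 < m)%N ->
          (forall i, (0 < i < m)%N -> X i `<` X i.+1) ->
          (forall i, (0 < i <= m)%N -> Pf_set (X i) (f i)) ->
          A (ssum 1%N (iota 1 m) (fun i : nat =>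
               alpha (X i) +s ssum posnat1 (elements (H (X i))) (f i))))].
Proof.
have inh : inhabited (S * Pf [set: posnat] * set S).
  have [a _] := filter_ex pA.
  have [|//|H _] := @increasing_elements [:: posnat1]; first by [].
  exact: (inhabits (a, H, set0)).
have [g gP] := well_founded_choice inh (@Pf_well_founded _ T)
  chain_spec_local chain_spec_step.
exists (fun F => (g F).1.1), (fun F => (g F).1.2); split.
- by move=> F; have [] := gP F.
- by move=> F G FG; have [_ /(_ F FG)] := gP G.
move=> m X f m0 XS fX; set b := fun i => _.
(* Induction along the chain: partial sums stay in the recorded sets, which lie in [star_part] and
   hence in [A]. *)
suff chain k : (0 < k <= m)%N -> (g (X k)).2 (ssum 1%N (iota 1 k) b).
  have [_ _ [_ gA] _ _] := gP (X m); apply: (gA _ _).1.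
  by apply: chain; rewrite m0 leqnn.
elim: k => // -[_ km|k IH km].
  by have [_ _ _ gb _] := gP (X 1%N); apply: gb; exact: fX.
have -> : iota 1 k.+2 = iota 1 k.+1 ++ [:: k.+2].
  by rewrite -[X in iota _ X](addn1 k.+1) iotaD add1n.
rewrite ssum_rcons ?size_iota//.
have [_ _ _ _ gb] := gP (X k.+2); apply: (gb (X k.+1)).
- exact: XS.
- by apply: IH; exact: ltnW.
- exact: fX.
Qed.

End CentralSets.

(** * The Central Sets Theorem near an idempotent of [S^w] *)

Theorem theorem3p5 (R : realType) (S : semitopSemigroupType)
    (addC : commutative (@sadd S))
    (plus : spectrum R S -> spectrum R S -> spectrum R S)
    (plusP : spectrum_operation plus)
    (eta : spectrum R S) (eta_remainder : spectrum_remainder eta)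
    (eta_idempotent : plus eta eta = eta)
    (A : set S) (A_central : central_near eta A)
    (U : set S) (eta_U : e_ultrafilter eta U) :
  exists (alpha : Pf (Tset eta) -> S) (H : Pf (Tset eta) -> Pf [set: posnat]),
    [/\ (forall F : Pf (Tset eta), U (alpha F)),
        (forall F G : Pf (Tset eta), F `<` G -> (Pf_max (H F) < Pf_min (H G))%N) &
        (forall (m : nat) (X : nat -> Pf (Tset eta)) (f : nat -> posnat -> S),
          (0 < m)%N ->
          (forall i, (0 < i < m)%N -> X i `<` X i.+1) ->
          (forall i, (0 < i <= m)%N -> Pf_set (X i) (f i)) ->
          A (ssum 1%N (iota 1 m) (fun i : nat =>
               alpha (X i) +s ssum posnat1 (elements (H (X i))) (f i))))].
Proof.
have [p [Kp pp pA]] := A_central.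
have pN : ProperFilter (trace_nbhs eta).
  by apply: trace_nbhs_proper; exists p; case: Kp.
rewrite star_setE in Kp.
apply: (@central_sets_chain S (trace_nbhs eta) p) => //.
- exact: trace_nbhs_idempotent plusP eta_idempotent.
- move=> F V m Ff FT NV; apply: (full_density_frequent m _ Ff FT NV) => G.
  exact: trace_nbhs_min.
- exact: e_ultrafilter_trace.
Qed.
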